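(* Let $A$ be a Buchsbaum local ring with maximal ideal $\mathfrak{m}$ and $\dim A = 1$. Let $W = \mathrm{H}^0_{\mathfrak{m}}(A)$ and $e = \mathrm{e}(A)$. Suppose that $e > 1$. Let $Q$ be a parameter ideal in $A$ and put $I = Q : \mathfrak{m}$. Then $$\mathrm{r}_Q(I) \leq \mathrm{r}(A) - \ell_A(I/Q) + 1 = \mathrm{r}(A/W) - \ell_A(I/(Q + W)) + 1.$$
   Context: A parameter ideal in $A$ is an ideal generated by a system of parameters. A Noetherian local ring $A$ with maximal ideal $\mathfrak{m}$ and $d = \dim A\geq 1$ is a Buchsbaum ring if the difference $\ell_A(A/Q) - \mathrm{e}^0_Q(A)$ is independent of the choice of a parameter ideal $Q$, where $\mathrm{e}^0_Q(A)$ is the multiplicity of $A$ with respect to $Q$; equivalently, every system of parameters $x_1,\dots,x_d$ satisfies $(x_1,\dots,x_{i-1}):x_i = (x_1,\dots,x_{i-1}):\mathfrak{m}$ for all $1\leq i\leq d$. $\mathrm{e}(A) = \mathrm{e}^0_{\mathfrak{m}}(A)$ is the multiplicity of $A$ with respect to $\mathfrak{m}$; $\ell_A$ denotes length; $\mathrm{H}^0_{\mathfrak{m}}$ is the zeroth local cohomology; $Q:\mathfrak{m} = \{x\in A \mid x\mathfrak{m}\subseteq Q\}$. The Cohen-Macaulay type is $\mathrm{r}(A) = \sup_Q \ell_A((Q:\mathfrak{m})/Q)$, where $Q$ runs over the parameter ideals in $A$; $\mathrm{r}(A/W)$ is defined in the same way for the (Cohen-Macaulay) local ring $A/W$. The reduction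 number of $I$ with respect to $Q$ is $\mathrm{r}_Q(I) = \min\{0 \leq n \in \mathbb{Z} \mid I^{n+1} = QI^n\}$. *)

(* Defs.v *)
(* Commutative algebra over the rings of MathComp; ideals are classical sets
   [set A], as the library's [idealr] covers only proper ideals.
   Numerical invariants that may be infinite or undefined (length, dimension,
   multiplicity, ...) are relations [inv x n], read "inv(x) is defined, finite
   and equal to n"; each of them determines n. *)
From HB Require Import structures.
From mathcomp Require Import all_boot all_order all_algebra.
From mathcomp Require Import boolp classical_sets.

Set Implicit Arguments.
Unset Strict Implicit.
Unset Printing Implicit Defensive.

Import Order.TTheory GRing.Theory Num.Theory.

Local Open Scope classical_set_scope.
Local Open Scope ring_scope.

Definition is_max (P : nat -> Prop) (n : nat) : Prop :=
  P n /\ forall k, P k -> (k <= n)%N.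

Definition is_min (P : nat -> Prop) (n : nat) : Prop :=
  P n /\ forall k, P k -> (n <= k)%N.

(* c 0 < c 1 < ... < c n, all in the class C; the values c i for i > n are
   irrelevant. *)
Definition strict_chain (T : Type) (C : set (set T)) (n : nat)
    (c : nat -> set T) : Prop :=
  (forall i, (i <= n)%N -> C (c i)) /\
  (forall i, (i < n)%N -> c i `<` c i.+1).

Section Ideals.
Variable A : comNzRingType.
Implicit Types (I J M N P Q m : set A) (n d l e r : nat).

Definition is_ideal I : Prop :=
  I 0 /\ forall a x y, I x -> I y -> I (a * x + y).

Definition is_prime P : Prop :=
  [/\ is_ideal P, ~ P 1 & forall x y, P (x * y) -> P x \/ P y].

Definition is_maximal M : Prop :=
  [/\ is_ideal M, ~ M 1 &
      forall J, is_ideal J -> ~ J 1 -> M `<=` J -> J = M].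

Definition ideal_gen (S : set A) : set A := smallest is_ideal S.

Definition ideal_add I J : set A := [set x + y | x in I & y in J].

Definition ideal_mul I J : set A := ideal_gen [set x * y | x in I & y in J].

(* I ^ 0 is the whole ring. *)
Definition ideal_exp I n : set A := iter n (ideal_mul I) setT.

Definition colon I J : set A := [set x | forall y, J y -> I (x * y)].

Definition radical I : set A := [set x | exists n, I (x ^+ n)].

Definition noetherian : Prop :=
  forall I, is_ideal I -> exists s : seq A, I = ideal_gen [set` s].

(* m is the unique maximal ideal of A. *)
Definition is_local m : Prop :=
  is_maximal m /\ forall M, is_maximal M -> M = m.

Definition krull_dim d : Prop :=
  is_max (fun k => exists c, strict_chain is_prime k c) d.

(* The length of the A-module M / N, for ideals N <= M: its submodules are the
   ideals between N and M.  No l satisfies this when N is not contained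
   in M. *)
Definition length_quot M N l : Prop :=
  is_max (fun k => exists c, [/\ strict_chain is_ideal k c, c 0%N = N & c k = M])
    l.

(* Ideals generated by dim A elements and primary to the maximal ideal m, i.e.
   of radical m. *)
Definition parameter_ideal m Q : Prop :=
  exists d (x : d.-tuple A),
    [/\ krull_dim d, Q = ideal_gen [set` x] & radical Q = m].

(* With d = dim A, the length of A / Q^(n+1) equals p(n) for n large, where p
   has degree at most d, and e is d! times the coefficient of degree d. *)
Definition multiplicity Q e : Prop :=
  exists d (p : {poly rat}),
    [/\ krull_dim d,
        (size p <= d.+1)%N,
        exists n0, forall n, (n0 <= n)%N ->
          exists l, length_quot setT (ideal_exp Q n.+1) l /\ p.[n%:R] = l%:R
      & e%:R = d`!%:R * p`_d].

Definition is_buchsbaum m : Prop :=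
  [/\ noetherian, is_local m,
      exists d, (1 <= d)%N /\ krull_dim d
    & exists c : int, forall Q, parameter_ideal m Q ->
        exists l e, [/\ length_quot setT Q l, multiplicity Q e
                      & l%:Z - e%:Z = c]].

(* Zeroth local cohomology H^0_m(A), as an ideal of A. *)
Definition local_coh0 m : set A :=
  [set x | exists n, forall y, ideal_exp m n y -> x * y = 0].

(* The supremum of the lengths of (Q : m) / Q over all parameter ideals Q; a
   finite supremum of a nonempty set of naturals is attained. *)
Definition cm_type m r : Prop :=
  (exists Q, parameter_ideal m Q /\ length_quot (colon Q m) Q r) /\
  (forall Q, parameter_ideal m Q ->
     exists l, length_quot (colon Q m) Q l /\ (l <= r)%N).

Definition reduction_number Q I n : Prop :=
  is_min (fun k => ideal_exp I k.+1 = ideal_mul Q (ideal_exp I k)) n.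

End Ideals.

Arguments krull_dim A d : clear implicits.
Arguments noetherian A : clear implicits.

Lemma ideal_gen_ideal (A : comNzRingType) (S : set A) : is_ideal (ideal_gen S).
Proof.
split; first by move=> J [[J0 _] _].
by move=> a x y Ix Iy J HJ; apply: HJ.1.2; [apply: Ix | apply: Iy].
Qed.

Lemma sub_ideal_gen (A : comNzRingType) (S : set A) : S `<=` ideal_gen S.
Proof. by move=> x Sx J [_]; apply. Qed.

(* Under these hypotheses H^0_m(A) is a proper ideal, so that it is the
   underlying set of an [idealr]. *)
Lemma local_coh0_idealr (A : comNzRingType) (m : set A) :
  is_local m -> krull_dim A 1 -> exists W : idealr A, [set` W] = local_coh0 m.
Proof.
move=> [[[m0 mD] m1 mmax] _] [[c [cP clt]] _].
have expI n : is_ideal (ideal_exp m n).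
  by case: n => [|n]; [split | exact: ideal_gen_ideal].
have expS n : ideal_exp m n.+1 `<=` ideal_exp m n.
  apply: smallest_sub; first exact: expI.
  move=> _ [x mx [y ny <-]]; have [z0 zD] := expI n.
  by have := zD x y 0 ny z0; rewrite addr0.
have expD n k : ideal_exp m (n + k) `<=` ideal_exp m n.
  by elim: k => [|k IH]; rewrite ?addn0 // addnS => x /expS /IH.
have Hc : idealr_closed [pred x | `[< local_coh0 m x >]].
  split.
  - by rewrite inE; exists 0%N => y _; rewrite mul0r.
  - apply/negP; rewrite inE => -[n Hn].
    have mP (P : set A) : is_prime P -> P = m.
      move=> [PI P1 PM]; apply: mmax => // x mx.
      have mX k : ideal_exp m k (x ^+ k).
        elim: k => [|k IH] //; apply: sub_ideal_gen.
        by exists x => //; exists (x ^+ k); rewrite // exprS.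
      have : P (x ^+ n) by rewrite -[x ^+ n]mul1r Hn //; exact: PI.1.
      by elim: (n) => [/P1 //|k IH]; rewrite exprS => /PM[].
    have := clt 0%N isT; rewrite (mP _ (cP 0%N isT)) (mP _ (cP 1%N isT)).
    by move=> [].
  - move=> a x y; rewrite !inE => -[n Hn] [k Hk].
    exists (n + k)%N => z mz.
    rewrite mulrDl -mulrA Hn; last exact: expD mz.
    by rewrite Hk ?mulr0 ?addr0 //; move: mz; rewrite addnC; apply: expD.
pose W : idealr A := HB.pack_for (idealr A) (fun x => `[< local_coh0 m x >])
  (isIdealr.Build A _ Hc).
exists W; by apply/seteqP; split => x; rewrite /= inE.
Qed.

(* Main.v *)
(* Write W = H^0_m(A), and Q = aA for a parameter a. The length of a^n A / a^(n+1) A is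
   that of A / (aA + W) for large n, so the Buchsbaum invariant is the length of
   W / (W n aA) for every parameter a. Since a high power of a meets W in 0, so does every
   parameter, and as the parameters generate m this gives mW = 0.

   Put I = aA : m and J = (aA + W) : m. The length of J / (aA + W) is r(A/W) for every a,
   and J = aA : m as soon as a is the square of a parameter, which yields the equality
   r(A) - l(I/Q) = r(A/W) - l(I/(Q + W)) = l(J/I).

   For the bound, e > 1 forbids m to be principal modulo W, and this forces
   IJ <= aJ + W. Hence the ideals E_k = {z | a^k z in I^(k+1) + W} form an ascending
   sequence between I and J, and E_k = E_(k+1) for some k <= l(J/I). This gives
   I^(k+2) <= a I^(k+1) + W, and W drops out because I^2 <= Q meets W in 0. *)
Require Import Defs.
From mathcomp Require Import all_boot all_order all_algebra.
From mathcomp Require Import boolp classical_sets.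
From mathcomp Require Import ring zify.

Import Order.TTheory GRing.Theory Num.Theory.

Set Implicit Arguments.
Unset Strict Implicit.
Unset Printing Implicit Defensive.

Local Open Scope classical_set_scope.
Local Open Scope quotient_scope.
Local Open Scope ring_scope.

(** * Ideals *)

Section IdealTheory.
Variable A : comNzRingType.
Implicit Types (I J K L M N S : set A) (a x y : A).

Definition pideal a : set A := [set z | exists t, z = a * t].

Lemma ideal0 I : is_ideal I -> I 0. Proof. by case. Qed.

Lemma ideal_mull I a x : is_ideal I -> I x -> I (a * x).
Proof. by move=> [I0 h] Ix; rewrite -[a * x]addr0; apply: h. Qed.

Lemma ideal_mulr I a x : is_ideal I -> I x -> I (x * a).
Proof. by rewrite mulrC; apply: ideal_mull. Qed.

Lemma idealD I x y : is_ideal I -> I x -> I y -> I (x + y).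
Proof. by move=> [I0 h] Ix Iy; rewrite -[x]mul1r; apply: h. Qed.

Lemma idealN I x : is_ideal I -> I x -> I (- x).
Proof. by move=> hI Ix; rewrite -mulN1r; apply: ideal_mull. Qed.

Lemma idealB I x y : is_ideal I -> I x -> I y -> I (x - y).
Proof. by move=> hI Ix Iy; apply: idealD => //; apply: idealN. Qed.

Lemma ideal_setT : @is_ideal A setT. Proof. by split. Qed.

Lemma ideal_setI I J : is_ideal I -> is_ideal J -> is_ideal (I `&` J).
Proof.
move=> [I0 hI] [J0 hJ]; split=> // a x y [Ix Jx] [Iy Jy].
by split; [apply: hI | apply: hJ].
Qed.

Lemma ideal_addP I J : is_ideal I -> is_ideal J -> is_ideal (ideal_add I J).
Proof.
move=> hI hJ; split.
  by exists 0; [exact: ideal0|exists 0; [exact: ideal0|rewrite addr0]].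
move=> a _ _ [x Ix [y Jy <-]] [u Iu [v Jv <-]].
exists (a * x + u); first exact: hI.2.
by exists (a * y + v); [exact: hJ.2 | rewrite mulrDr addrACA].
Qed.

Lemma ideal_addl I J : is_ideal J -> I `<=` ideal_add I J.
Proof. by move=> hJ x Ix; exists x => //; exists 0; [exact: ideal0|rewrite addr0]. Qed.

Lemma ideal_addr I J : is_ideal I -> J `<=` ideal_add I J.
Proof. by move=> hI x Ix; exists 0; [exact: ideal0|exists x => //; rewrite add0r]. Qed.

Lemma ideal_add_sub I J K : is_ideal K -> I `<=` K -> J `<=` K ->
  ideal_add I J `<=` K.
Proof. by move=> hK IK JK _ [x /IK Kx [y /JK Ky <-]]; apply: idealD. Qed.

Lemma ideal_add_mono I I' J J' : I `<=` I' -> J `<=` J' ->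
  ideal_add I J `<=` ideal_add I' J'.
Proof. by move=> II' JJ' _ [x /II' Ix [y /JJ' Jy <-]]; exists x => //; exists y. Qed.

Lemma ideal_addC I J : ideal_add I J = ideal_add J I.
Proof.
by apply/seteqP; split=> _ [x Ix [y Jy <-]]; exists y => //; exists x; rewrite // addrC.
Qed.

Lemma ideal_gen_min S I : is_ideal I -> S `<=` I -> ideal_gen S `<=` I.
Proof. by move=> hI SI; apply: smallest_sub. Qed.

Lemma ideal_mulP I J : is_ideal (ideal_mul I J).
Proof. exact: ideal_gen_ideal. Qed.

Lemma mem_ideal_mul I J x y : I x -> J y -> ideal_mul I J (x * y).
Proof. by move=> Ix Jy; apply: sub_ideal_gen; exists x => //; exists y. Qed.

Lemma ideal_mul_sub I J K : is_ideal K -> (forall x y, I x -> J y -> K (x * y)) ->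
  ideal_mul I J `<=` K.
Proof. by move=> hK h; apply: ideal_gen_min => // _ [x Ix [y Jy <-]]; apply: h. Qed.

Lemma ideal_expP I n : is_ideal (ideal_exp I n).
Proof. by case: n => [|n]; [exact: ideal_setT | exact: ideal_mulP]. Qed.

Lemma ideal_exp_anti I n : ideal_exp I n.+1 `<=` ideal_exp I n.
Proof.
apply: ideal_mul_sub; first exact: ideal_expP.
by move=> x y _; apply: ideal_mull; exact: ideal_expP.
Qed.

Lemma mem_ideal_exp I x n : I x -> ideal_exp I n (x ^+ n).
Proof. by move=> Ix; elim: n => // n IH; rewrite exprS; apply: mem_ideal_mul. Qed.

Lemma ideal_exp1 I : is_ideal I -> ideal_exp I 1 = I.
Proof.
move=> hI; apply/seteqP; split=> [|x Ix].
  by apply: ideal_mul_sub => // x y Ix _; apply: ideal_mulr.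
by rewrite -[x]mulr1; apply: mem_ideal_mul.
Qed.

Lemma ideal_colon I J : is_ideal I -> is_ideal (colon I J).
Proof.
move=> hI; split=> [y _|a x y Ix Iy z Jz]; first by rewrite mul0r; apply: ideal0.
by rewrite mulrDl -mulrA; apply: hI.2; [apply: Ix | apply: Iy].
Qed.

Lemma ideal_pideal a : is_ideal (pideal a).
Proof.
split; first by exists 0; rewrite mulr0.
by move=> b _ _ [s ->] [t ->]; exists (b * s + t); ring.
Qed.

Lemma mem_pideal a : pideal a a. Proof. by exists 1; rewrite mulr1. Qed.

Lemma pideal_sub a I : is_ideal I -> I a -> pideal a `<=` I.
Proof. by move=> hI Ia _ [t ->]; apply: ideal_mulr. Qed.

Lemma ideal_gen_tuple1 (x : 1.-tuple A) : ideal_gen [set` x] = pideal (thead x).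
Proof.
case/tupleP: x => a x; rewrite theadE; have -> := tuple0 x.
apply/seteqP; split.
  apply: ideal_gen_min; first exact: ideal_pideal.
  by move=> y /=; rewrite inE => /eqP ->; exact: mem_pideal.
apply: pideal_sub; first exact: ideal_gen_ideal.
by apply: sub_ideal_gen; rewrite /= inE.
Qed.

Lemma ideal_mul_pideal a I : is_ideal I ->
  ideal_mul (pideal a) I = [set z | exists2 y, I y & z = a * y].
Proof.
move=> hI; apply/seteqP; split; last first.
  by move=> _ [y Iy ->]; apply: mem_ideal_mul => //; exact: mem_pideal.
apply: ideal_mul_sub; last first.
  move=> _ y [t ->] Iy; exists (t * y); first exact: ideal_mull.
  by rewrite mulrA.
split; first by exists 0; [exact: ideal0 | rewrite mulr0].
move=> b _ _ [s Is ->] [t It ->]; exists (b * s + t); first exact: hI.2.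
by ring.
Qed.

Lemma ideal_exp_pideal a n : ideal_exp (pideal a) n = pideal (a ^+ n).
Proof.
elim: n => [|n IH].
  apply/seteqP; split=> // x _; exists x; by rewrite expr0 mul1r.
have -> : ideal_exp (pideal a) n.+1 = ideal_mul (pideal a) (pideal (a ^+ n)).
  by rewrite -IH.
rewrite ideal_mul_pideal; last exact: ideal_pideal.
apply/seteqP; split=> [_ [_ [t ->] ->]|_ [t ->]].
  by exists t; rewrite exprS mulrA.
by exists (a ^+ n * t); [exists t | rewrite exprS mulrA].
Qed.

End IdealTheory.

(** * Chains of ideals and length *)

Section Length.
Variable A : comNzRingType.
Implicit Types (I J K L M N : set A).

Definition chain N M k := exists c : nat -> set A,
  [/\ strict_chain (@is_ideal _) k c, c 0%N = N & c k = M].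

Lemma chain0 N : is_ideal N -> chain N N 0.
Proof. by move=> hN; exists (fun=> N); split=> //; split. Qed.

Lemma chainS N M M' k : chain N M k -> is_ideal M' -> M `<` M' ->
  chain N M' k.+1.
Proof.
move=> [c [[cI clt] c0 ck]] hM' lt.
exists (fun i => if (i <= k)%N then c i else M'); split; last first.
- by rewrite ltnn.
- by rewrite leq0n.
split=> [i|i].
  by move=> _; case: ifP => // /cI.
rewrite ltnS => ik; rewrite ik; case: ifP => [/clt //|].
move=> /negbT; rewrite -leqNgt => ki.
by have -> : i = k by [apply/eqP; rewrite eqn_leq ik ki]; rewrite ck.
Qed.

(** Induction on the top step of a chain hides the enumerating function [c]. *)
Lemma chain_ind (P : set A -> nat -> Prop) N :
  (is_ideal N -> P N 0%N) ->
  (forall M M' k, chain N M k -> P M k -> is_ideal M -> is_ideal M' -> M `<` M' ->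
     P M' k.+1) ->
  forall M k, chain N M k -> P M k.
Proof.
move=> P0 PS M k [c [[cI clt] c0 <-]].
have H i : (i <= k)%N -> chain N (c i) i /\ P (c i) i.
  elim: i => [|i IH] ik.
    by rewrite c0; split; [apply: chain0 | apply: P0]; rewrite -c0; apply: cI.
  have [ch Pi] := IH (ltnW ik).
  split; first by apply: chainS ch _ _; [apply: cI | apply: clt].
  by apply: PS ch Pi _ _ _; [apply: cI; apply: ltnW | apply: cI | apply: clt].
by have [] := H k (leqnn k).
Qed.

Lemma chain_sub N M k : chain N M k -> [/\ N `<=` M, is_ideal N & is_ideal M].
Proof.
elim/chain_ind => [hN|M1 M2 k1 _ [NM1 hN _] _ hM2 [M12 _]]; split=> //.
exact: subset_trans M12.
Qed.

Lemma chain_cat N K M p q : chain N K p -> chain K M q -> chain N M (p + q).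
Proof.
move=> cNK; elim/chain_ind => [_|M1 M2 k _ IH hM1 hM2 lt]; first by rewrite addn0.
by rewrite addnS; apply: chainS IH _ _.
Qed.

Lemma chain_neq0 N M k : chain N M k -> (0 < k)%N -> M <> N.
Proof.
move=> h; elim/chain_ind : h => // M1 M2 k1 /chain_sub [NM1 _ _] _ _ _ [_ M21] _ E.
by apply: M21; rewrite E.
Qed.

(** Serves to prolong a chain through a possibly trivial inclusion; the second clause recovers a
    strict step when the two ideals differ. *)
Lemma chain_le N M : is_ideal N -> is_ideal M -> N `<=` M ->
  exists k, chain N M k /\ (N <> M -> k = 1%N).
Proof.
move=> hN hM NM; have [->|neq] := pselect (N = M).
  by exists 0%N; split => //; exact: chain0.
exists 1%N; split => //; apply: chainS (chain0 hN) hM _; split=> // MN.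
by apply: neq; apply/seteqP.
Qed.

(** By the modular law a strict step stays strict after intersecting with [K] or after adding [K],
    so each step of the given chain is counted in one of the two new ones. This is the core of the
    additivity of length. *)
Lemma chain_split N K M k : is_ideal K -> N `<=` K -> chain N M k -> K `<=` M ->
  exists p q, [/\ chain N K p, chain K M q & (k <= p + q)%N].
Proof.
move=> hK NK ch KM.
(* In this form the claim passes up the chain; at the top, the trace on [K] is [K] and the sum with
   [K] is [M]. *)
suff [p [q [h1 h2 h3]]] : exists p q, [/\ chain N (M `&` K) p,
    chain K (ideal_add M K) q & (k <= p + q)%N].
  have E1 : M `&` K = K by apply/seteqP; split=> x; [case|split=> //; apply: KM].
  have [_ _ hM] := chain_sub ch.
  have E2 : ideal_add M K = M.
    apply/seteqP; split; first exact: ideal_add_sub.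
    exact: ideal_addl.
  by exists p, q; move: h1 h2; rewrite E1 E2.
elim/chain_ind: ch {KM} => [hN|M1 M2 j _ [p [q [h1 h2 h3]]] hM1 hM2 [M12 M21]].
  exists 0%N, 0%N; split=> //.
    have -> : N `&` K = N by apply/seteqP; split=> x; [case|split=> //; apply: NK].
    exact: chain0.
  have -> : ideal_add N K = K.
    apply/seteqP; split; first exact: ideal_add_sub.
    exact: ideal_addr.
  exact: chain0.
have hI2 := ideal_setI hM2 hK; have hS2 := ideal_addP hM2 hK.
have [s|ns] := pselect (M2 `&` K `<=` M1 `&` K); last first.
  have [_ _ hS1] := chain_sub h2.
  have sub : ideal_add M1 K `<=` ideal_add M2 K by exact: ideal_add_mono.
  have [r [h4 _]] := chain_le hS1 hS2 sub.
  exists p.+1, (q + r)%N; split; last by rewrite addSn ltnS; lia.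
    apply: chainS h1 hI2 _; split=> // x [] M1x Kx; split=> //; exact: M12.
  exact: chain_cat h2 h4.
(* The traces agree, so the sums with [K] must differ: otherwise x in [M2] is y + z with y in [M1]
   and z in the trace of [M2] on [K], hence in [M1]. *)
have E : M2 `&` K = M1 `&` K.
  by apply/seteqP; split=> // x [M1x Kx]; split=> //; exact: M12.
exists p, q.+1; rewrite E; split=> //; last by rewrite addnS ltnS.
apply: chainS h2 hS2 _; split; first exact: ideal_add_mono.
move=> s'; apply: M21 => x M2x.
have [y M1y [z Kz xE]] := s' _ (ideal_addl hK M2x).
have /s [M1z _] : (M2 `&` K) z.
  split=> //; rewrite (_ : z = x - y); last by rewrite -xE; ring.
  by apply: idealB => //; exact: M12.
by rewrite -xE; apply: idealD.
Qed.

Lemma length_uniq M N k l : length_quot M N k -> length_quot M N l -> k = l.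
Proof.
by move=> [h1 h2] [h3 h4]; apply/eqP; rewrite eqn_leq h2 // h4.
Qed.

Lemma length_sub M N l : length_quot M N l -> [/\ N `<=` M, is_ideal N & is_ideal M].
Proof. by move=> [h _]; exact: chain_sub h. Qed.

Lemma length_le M N l k : length_quot M N l -> chain N M k -> (k <= l)%N.
Proof. by move=> [_ h]; apply: h. Qed.

Lemma length_bounded M N b : is_ideal M -> is_ideal N -> N `<=` M ->
  (forall k, chain N M k -> (k <= b)%N) ->
  exists2 l, length_quot M N l & (l <= b)%N.
Proof.
move=> hM hN NM hb.
have ex : exists k, (fun k => `[< chain N M k >]) k.
  by have [k [h _]] := chain_le hN hM NM; exists k; apply/asboolP.
have ub k : (fun k => `[< chain N M k >]) k -> (k <= b)%N by move/asboolP; apply: hb.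
case: (ex_maxnP ex ub) => l /asboolP hl hmax.
exists l; last exact: hb.
by split=> // k hk; apply: hmax; apply/asboolP.
Qed.

(** Chains in either half extend to chains of the whole, which bounds both halves; [chain_split]
    gives the remaining inequality. *)
Lemma length_split M K N l : length_quot M N l -> is_ideal K ->
  N `<=` K -> K `<=` M ->
  exists p q, [/\ length_quot M K p, length_quot K N q & l = (p + q)%N].
Proof.
move=> hl hK NK KM; have [NM hN hM] := length_sub hl.
have [k0 [c0 _]] := chain_le hN hK NK; have [k1 [c1 _]] := chain_le hK hM KM.
have [|p hp _] := @length_bounded M K l hM hK KM.
  by move=> k hk; have := length_le hl (chain_cat c0 hk); lia.
have [|q hq _] := @length_bounded K N l hK hN NK.
  by move=> k hk; have := length_le hl (chain_cat hk c1); lia.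
exists p, q; split=> //; apply/eqP; rewrite eqn_leq; apply/andP; split.
  have [p' [q' [h1 h2 h3]]] := chain_split hK NK hl.1 KM.
  by have := length_le hp h2; have := length_le hq h1; lia.
by have := length_le hl (chain_cat hq.1 hp.1); lia.
Qed.

Lemma length_add M K N p q : length_quot M K p -> length_quot K N q ->
  length_quot M N (p + q).
Proof.
move=> hp hq; have [NK hN hK] := length_sub hq; have [KM _ hM] := length_sub hp.
split; first by rewrite addnC; exact: chain_cat hq.1 hp.1.
move=> k hk; have [p' [q' [h1 h2 h3]]] := chain_split hK NK hk KM.
by have := length_le hp h2; have := length_le hq h1; lia.
Qed.

Lemma length_eq M N : length_quot M N 0 -> M = N.
Proof.
move=> hl; have [NM hN hM] := length_sub hl.
have [k [hk h1]] := chain_le hN hM NM; apply: contrapT => neq.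
by have := length_le hl hk; rewrite h1 // => E; apply: neq.
Qed.

Lemma length_self N : is_ideal N -> length_quot N N 0.
Proof.
move=> hN; split; first exact: chain0.
by move=> k /chain_neq0 h; rewrite leqNgt; apply/negP => /h.
Qed.

(* In an interval [N, M] of finite length, ascending sequences stop growing at
   an explicitly bounded index, without any noetherian hypothesis. *)
Lemma length_ascending (E : nat -> set A) M N l : length_quot M N l ->
  (forall i, is_ideal (E i)) -> (forall i, N `<=` E i) -> (forall i, E i `<=` M) ->
  (forall i, E i `<=` E i.+1) -> exists2 i, (i <= l)%N & E i.+1 = E i.
Proof.
move=> hl hE NE EM inc; apply: contrapT => hn.
have ch i : (i <= l.+1)%N -> chain (E 0%N) (E i) i.
  elim: i => [|i IH] il; first exact: chain0.
  apply: chainS (IH (ltnW il)) _ _ => //; split=> // h.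
  by apply: hn; exists i => //; apply/seteqP; split.
have [_ hN hM] := length_sub hl.
have [k0 [c0 _]] := chain_le hN (hE 0%N) (NE 0%N).
have [k1 [c1 _]] := chain_le (hE l.+1) hM (EM l.+1).
by have := length_le hl (chain_cat c0 (chain_cat (ch _ (leqnn _)) c1)); lia.
Qed.

Lemma length_descending (E : nat -> set A) M N l : length_quot M N l ->
  (forall i, is_ideal (E i)) -> (forall i, N `<=` E i) -> (forall i, E i `<=` M) ->
  (forall i, E i.+1 `<=` E i) -> exists i, E i.+1 = E i.
Proof.
move=> hl hE NE EM dec; apply: contrapT => hn.
have ch i : chain (E i) (E 0%N) i.
  elim: i => [|i IH]; first exact: chain0.
  rewrite -add1n; apply: chain_cat IH; apply: chainS (chain0 (hE _)) _ _ => //.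
  by split=> // h; apply: hn; exists i; apply/seteqP; split.
have [_ hN hM] := length_sub hl.
have [k0 [c0 _]] := chain_le hN (hE l.+1) (NE l.+1).
have [k1 [c1 _]] := chain_le (hE 0%N) hM (EM 0%N).
by have := length_le hl (chain_cat c0 (chain_cat (ch _) c1)); lia.
Qed.

End Length.

Lemma chain_map (A B : comNzRingType) (f : set A -> set B) N M k : chain N M k ->
  (forall K, is_ideal K -> N `<=` K -> K `<=` M -> is_ideal (f K)) ->
  (forall K L, is_ideal K -> is_ideal L -> N `<=` K -> K `<` L -> L `<=` M ->
     f K `<` f L) ->
  chain (f N) (f M) k.
Proof.
elim/chain_ind => [hN|M1 M2 j ch IH hM1 hM2 lt] hf1 hf2.
  by apply: chain0; apply: hf1.
have [NM1 hN _] := chain_sub ch.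
apply: (@chainS _ _ (f M1)).
- apply: IH => [K hK NK KM|K L hK hL NK KL LM];
    [apply: hf1 | apply: hf2] => //; exact: subset_trans lt.1.
- by apply: hf1 => //; apply: subset_trans lt.1.
- exact: hf2.
Qed.

(** Length depends only on the lattice of ideals in the interval; allowing two rings covers
    multiplication by an element as well as passage to a quotient. *)
Lemma length_iso (A B : comNzRingType) (f : set A -> set B) (g : set B -> set A)
    N M N' M' l :
  length_quot M N l -> f N = N' -> f M = M' ->
  (forall K, is_ideal K -> N `<=` K -> K `<=` M ->
     is_ideal (f K) /\ g (f K) = K) ->
  (forall K, is_ideal K -> N' `<=` K -> K `<=` M' ->
     is_ideal (g K) /\ f (g K) = K) ->
  (forall K L, K `<=` L -> f K `<=` f L) ->
  (forall K L, K `<=` L -> g K `<=` g L) ->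
  length_quot M' N' l.
Proof.
move=> hl fN fM hf hg mf mg; have [NM hN hM] := length_sub hl.
have gN : g N' = N by rewrite -fN; apply: (hf N _ _ _).2.
have gM : g M' = M by rewrite -fM; apply: (hf M _ _ _).2.
split=> [|k hk].
  rewrite -fN -fM; apply: chain_map hl.1 _ _ => [K hK NK KM|K L hK hL NK [KL LK] LM].
    by have [] := hf K hK NK KM.
  split; first exact: mf.
  move=> /mg; rewrite (hf K _ _ _).2 // ?(hf L _ _ _).2 //.
    exact: subset_trans KL.
  exact: subset_trans LM.
apply: (length_le hl); rewrite -gN -gM.
apply: chain_map hk _ _ => [K hK NK KM|K L hK hL NK [KL LK] LM].
  by have [] := hg K hK NK KM.
split; first exact: mg.
move=> /mf; rewrite (hg K _ _ _).2 // ?(hg L _ _ _).2 //.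
  exact: subset_trans KL.
exact: subset_trans LM.
Qed.

(* Multiplication by x identifies M / (M n (N : x)) with (xM + N) / N. *)
Lemma length_mul (A : comNzRingType) (x : A) (M N P L : set A) l :
  is_ideal M -> is_ideal N ->
  L = [set z | M z /\ N (x * z)] ->
  P = [set z | exists u v, [/\ M u, N v & z = x * u + v]] ->
  length_quot M L l <-> length_quot P N l.
Proof.
move=> hM hN -> -> {P L}.
pose f (K : set A) : set A := [set z | exists u v, [/\ K u, N v & z = x * u + v]].
pose g (K : set A) : set A := [set z | M z /\ K (x * z)].
rewrite -/(f M) -/(g N).
have NfK K : is_ideal K -> N `<=` f K.
  by move=> hK v Nv; exists 0, v; split=> //; [exact: ideal0 | ring].
have fmono K L : K `<=` L -> f K `<=` f L.
  by move=> KL _ [u [v [Ku Nv ->]]]; exists u, v; split=> //; exact: KL.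
have gmono K L : K `<=` L -> g K `<=` g L.
  by move=> KL z [Mz Kz]; split=> //; exact: KL.
have fI K : is_ideal K -> is_ideal (f K).
  move=> hK; split.
    exists 0, 0; split; [exact: ideal0|exact: ideal0|ring].
  move=> a _ _ [u [v [Ku Nv ->]]] [u' [v' [Ku' Nv' ->]]].
  exists (a * u + u'), (a * v + v'); split; [exact: hK.2|exact: hN.2|ring].
have gI K : is_ideal K -> is_ideal (g K).
  move=> hK; split; first by split; [|rewrite mulr0]; exact: ideal0.
  move=> a y z [My Ky] [Mz Kz]; split; first exact: hM.2.
  by rewrite mulrDr mulrCA; exact: hK.2.
have gf K : is_ideal K -> g N `<=` K -> K `<=` M -> g (f K) = K.
  move=> hK NK KM; apply/seteqP; split=> [z [Mz [u [v [Ku Nv E]]]]|z Kz].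
    rewrite -[z](subrK u); apply: idealD => //; apply: NK; split.
      by apply: idealB => //; exact: KM.
    by rewrite mulrBr E addrAC subrr add0r.
  split; first exact: KM.
  by exists z, 0; split; [|exact: ideal0|rewrite addr0].
have fg K : is_ideal K -> N `<=` K -> K `<=` f M -> f (g K) = K.
  move=> hK NK KM; apply/seteqP; split=> [_ [u [v [[Mu Ku] Nv ->]]]|z Kz].
    by apply: idealD => //; exact: NK.
  have [u [v [Mu Nv E]]] := KM z Kz.
  exists u, v; split=> //; split=> //.
  by rewrite (_ : x * u = z - v); [apply: idealB => //; exact: NK|rewrite E addrK].
have fgN : f (g N) = N by apply: fg => //; exact: NfK.
have gfM : g (f M) = M by apply: gf => // z [].
split=> hl.
  apply: (@length_iso _ _ f g _ _ _ _ _ hl) => // K hK h1 h2.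
    by split; [exact: fI | exact: gf].
  by split; [exact: gI | exact: fg].
apply: (@length_iso _ _ g f _ _ _ _ _ hl) => // K hK h1 h2.
  by split; [exact: gI | exact: fg].
by split; [exact: fI | exact: gf].
Qed.

Lemma length_second_iso (A : comNzRingType) (M N : set A) l :
  is_ideal M -> is_ideal N ->
  length_quot M (M `&` N) l <-> length_quot (ideal_add M N) N l.
Proof.
move=> hM hN; apply: (length_mul (x := 1)) => //.
  by apply/seteqP; split=> z /=; rewrite mul1r.
apply/seteqP; split=> [_ [u Mu [v Nv <-]]|_ [u [v [Mu Nv ->]]]].
  by exists u, v; rewrite mul1r.
by rewrite mul1r; exists u => //; exists v.
Qed.

(** * Local rings *)

Section LocalRing.
Variables (A : comNzRingType) (m : set A).
Hypothesis hloc : is_local m.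
Implicit Types (I J K L M N : set A) (a x y z : A).

Lemma maxideal : is_ideal m. Proof. by case: hloc => -[]. Qed.

Lemma maxideal1 : ~ m 1. Proof. by case: hloc => -[]. Qed.

Lemma proper_ideal_sub I : is_ideal I -> ~ I 1 -> I `<=` m.
Proof.
move=> hI I1.
pose P J := J = set0 \/ [/\ is_ideal J, ~ J 1 & I `<=` J].
have [|M [PM maxM]] := @Zorn_bigcup A P.
  move=> F FP tot; have [[J0 [FJ0 neJ]]|no] :=
    pselect (exists J, F J /\ J <> set0); last first.
    left; apply/seteqP; split=> // x [J FJ Jx].
    by apply: no; exists J; split=> // J0; rewrite J0 in Jx.
  have FI J x : F J -> J x -> [/\ is_ideal J, ~ J 1 & I `<=` J].
    by move=> FJ Jx; have [E|//] := FP J FJ; rewrite E in Jx.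
  have [E|[hJ0 _ IJ0]] := FP J0 FJ0; first by case: neJ.
  right; split.
  - split; first by exists J0 => //; exact: ideal0.
    move=> a x y [J FJ Jx] [K FK Ky]; have [hJ _ _] := FI J x FJ Jx.
    have [hK _ _] := FI K y FK Ky; have [JK|KJ] := tot J K FJ FK.
      by exists K => //; apply: hK.2 => //; exact: JK.
    by exists J => //; apply: hJ.2 => //; exact: KJ.
  - by move=> [J FJ J1]; have [] := FI J 1 FJ J1.
  - by move=> x Ix; exists J0 => //; exact: IJ0.
have PI : P I by right; split.
have [E|[hM M1 IM]] := PM.
  exfalso; apply: (maxM I) => //; rewrite E; split=> // h.
  exact: (h 0 (ideal0 hI)).
suff <- : M = m by [].
apply: hloc.2; split=> // J hJ J1 MJ; apply: contrapT => neq.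
apply: (maxM J); last by right; split=> //; exact: subset_trans MJ.
by split=> // JM; apply: neq; apply/seteqP.
Qed.

Lemma unit_of_notin_max x : ~ m x -> exists y, x * y = 1.
Proof.
move=> mx; apply: contrapT => nu; apply: mx.
apply: (proper_ideal_sub (ideal_pideal x)); last exact: mem_pideal.
by move=> [t E]; apply: nu; exists t.
Qed.

Lemma maxideal_prime : is_prime m.
Proof.
split; [exact: maxideal|exact: maxideal1|move=> x y mxy].
have [|nx] := pselect (m x); [by left | right].
have [z E] := unit_of_notin_max nx.
have -> : y = z * (x * y) by rewrite mulrA [z * x]mulrC E mul1r.
exact: ideal_mull maxideal mxy.
Qed.

Lemma max_of_expr x n : m (x ^+ n) -> m x.
Proof.
elim: n => [|n IH]; first by rewrite expr0 => /maxideal1.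
by rewrite exprS => h; have [_ _ /(_ _ _ h) []] := maxideal_prime.
Qed.

Lemma unit_sub1 x : m x -> exists y, (1 - x) * y = 1.
Proof.
move=> mx; apply: unit_of_notin_max => h; apply: maxideal1.
by rewrite -[1](subrK x); apply: idealD => //; exact: maxideal.
Qed.

Section Noetherian.
Hypothesis hnoeth : noetherian A.

(** The finitely many generators of J are discarded one by one: if J lies in K + (x, s), then it
    already lies in K + (s). *)
Lemma nakayama J K : is_ideal J -> is_ideal K ->
  J `<=` ideal_add K (ideal_mul m J) -> J `<=` K.
Proof.
move=> hJ hK JK; have [s Js] := hnoeth hJ.
have hS (t : seq A) : is_ideal (ideal_gen [set` t]) by exact: ideal_gen_ideal.
have sJ : {in s, forall x, J x} by move=> x xs; rewrite Js; apply: sub_ideal_gen.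
have : J `<=` ideal_add K (ideal_gen [set` s]).
  by rewrite -Js; exact: ideal_addr.
elim: {Js} s sJ => [_|x s IH sJ] Js.
  apply: subset_trans Js _; apply: ideal_add_sub => //.
  by apply: ideal_gen_min.
apply: IH => [y ys|]; first by apply: sJ; rewrite inE ys orbT.
set T := ideal_add K _; have hT : is_ideal T by apply: ideal_addP.
(* An element of mJ is a combination of generators with coefficients in m, so only the coefficient
   of x has to be tracked. *)
have step : J `<=` [set z | exists u v, [/\ m u, T v & z = u * x + v]].
  have hR : is_ideal [set z | exists u v, [/\ m u, T v & z = u * x + v]].
    split.
      exists 0, 0; split; [exact: ideal0 maxideal|exact: ideal0|ring].
    move=> a _ _ [u [v [mu Tv ->]]] [u' [v' [mu' Tv' ->]]].
    exists (a * u + u'), (a * v + v'); split; last ring.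
      exact: maxideal.2.
    exact: hT.2.
  apply: subset_trans JK _; apply: ideal_add_sub => //.
    move=> z Kz; exists 0, z; split; [exact: ideal0 maxideal| |ring].
    exact: ideal_addl.
  apply: ideal_mul_sub => // y z my /Js [k Kk [w xw <-]].
  have : (exists c v, ideal_gen [set` s] v /\ w = c * x + v).
    move: w xw; apply: ideal_gen_min.
      split; first by exists 0, 0; split; [exact: ideal0|ring].
      move=> a _ _ [c [v [sv ->]]] [c' [v' [sv' ->]]].
      exists (a * c + c'), (a * v + v'); split; last by ring.
      exact: (hS s).2.
    move=> w /=; rewrite inE => /orP[/eqP ->|ws].
      by exists 1, 0; split; [exact: ideal0|ring].
    by exists 0, w; split; [exact: sub_ideal_gen|ring].
  move=> [c [v [sv ->]]]; exists (y * c), (y * (k + v)); split; last by ring.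
    exact: ideal_mulr maxideal my.
  by apply: ideal_mull => //; exists k => //; exists v.
(* Applied to x itself, [step] puts (1 - u) x in T, and 1 - u is a unit. *)
have Tx : T x.
  have [u [v [mu Tv E]]] := step x (sJ x (mem_head _ _)).
  have [w Ew] := unit_sub1 mu.
  rewrite (_ : x = w * v); first exact: ideal_mull.
  have -> : v = (1 - u) * x by rewrite {1}mulrBl mul1r {1}E; ring.
  by rewrite mulrA [w * _]mulrC Ew mul1r.
move=> z /step [u [v [mu Tv ->]]]; apply: idealD => //; exact: ideal_mull.
Qed.

Lemma nakayama_pideal x J K : m x -> is_ideal J -> is_ideal K ->
  (forall j, J j -> exists k i, [/\ K k, J i & j = k + x * i]) -> J `<=` K.
Proof.
move=> mx hJ hK h; apply: nakayama => // j /h [k [i [Kk Ji ->]]].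
by exists k => //; exists (x * i) => //; exact: mem_ideal_mul.
Qed.

End Noetherian.

(** * Parameters in dimension one *)

(** The ideal aA is m-primary; in dimension one these are exactly the parameter ideals. *)
Definition param a := radical (pideal a) = m.

Lemma param_max a : param a -> m a.
Proof. by move=> <-; exists 1%N; rewrite expr1; exact: mem_pideal. Qed.

Lemma paramP a : m a -> (forall x, m x -> exists n, pideal a (x ^+ n)) -> param a.
Proof.
move=> ma h; apply/seteqP; split=> x; last exact: h.
move=> [n hn]; apply: (@max_of_expr _ n).
exact: (pideal_sub maxideal ma).
Qed.

Lemma param_radical a x : param a -> m x -> exists n, pideal a (x ^+ n).
Proof. by move=> <-. Qed.

Lemma paramM a b : param a -> param b -> param (a * b).
Proof.
move=> pa pb; apply: paramP => [|x mx].
  exact: ideal_mull maxideal (param_max pb).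
have [n [s E]] := param_radical pa mx; have [k [t E']] := param_radical pb mx.
by exists (n + k)%N, (s * t); rewrite exprD E E'; ring.
Qed.

Lemma paramX a n : param a -> param (a ^+ n.+1).
Proof. by move=> pa; elim: n => [|n IH]; rewrite ?expr1 // exprS; apply: paramM. Qed.

End LocalRing.

Lemma krull_dim_uniq (A : comNzRingType) k l : krull_dim A k -> krull_dim A l -> k = l.
Proof. by move=> [h1 h2] [h3 h4]; apply/eqP; rewrite eqn_leq h2 // h4. Qed.

Lemma parameter_ideal_dim1 (A : comNzRingType) (m Q : set A) : krull_dim A 1 ->
  parameter_ideal m Q <-> exists2 a, Q = pideal a & param m a.
Proof.
move=> hd; split=> [[d [x [hd']]]|[a -> pa]].
  have E := krull_dim_uniq hd' hd; move: x; rewrite E => x.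
  by rewrite ideal_gen_tuple1 => -> <-; exists (thead x).
exists 1%N, [tuple a]; split=> //.
by rewrite ideal_gen_tuple1.
Qed.

(** The polynomial has degree at most 1, so its first difference is its coefficient of degree 1,
    which is e because 1! = 1. *)
Lemma multiplicity_dim1 (A : comNzRingType) (Q : set A) e : krull_dim A 1 ->
  multiplicity Q e -> exists n0, forall n, (n0 <= n)%N ->
    length_quot (ideal_exp Q n.+1) (ideal_exp Q n.+2) e.
Proof.
move=> hd [d [p [hd' + [n0 hn] he]]].
rewrite (krull_dim_uniq hd' hd) in he * => sp.
exists n0 => n n0n.
have [l [hl pl]] := hn n n0n; have [k [hk pk]] := hn n.+1 (leqW n0n).
have [q [r [h1 h2 E]]] := length_split hk (ideal_expP Q n.+1)
  (@ideal_exp_anti _ Q n.+1) (fun _ _ => I).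
have {}E : k = (l + r)%N by rewrite (length_uniq hl h1).
suff -> : e = r by [].
have ev x : p.[x] = p`_0 + p`_1 * x.
  rewrite (horner_coef_wide _ sp) !big_ord_recl big_ord0 /= expr0 expr1.
  by rewrite mulr1 addr0.
apply/eqP; rewrite -(eqr_nat rat) he (_ : 1`! = 1%N) // mul1r.
move: pl pk; rewrite !ev E -natr1 natrD => <- /eqP.
by rewrite mulrDr mulr1 addrA (inj_eq (addrI _)).
Qed.

(** * Buchsbaum rings of dimension one *)

Section Buchsbaum.
Variables (A : comNzRingType) (m W : set A).
Hypotheses (hA : is_buchsbaum m) (hdim : krull_dim A 1).
Hypotheses (hWI : is_ideal W) (hW : W = local_coh0 m).
Implicit Types (I J K L M N : set A) (a b x y z : A).

Let hnoeth : noetherian A. Proof. by case: hA. Qed.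
Let hloc : is_local m. Proof. by case: hA. Qed.
Let hm : is_ideal m. Proof. exact: maxideal. Qed.

Local Notation param := (param m).

Lemma param_length a : param a -> exists l, length_quot setT (pideal a) l.
Proof.
move=> pa; have [_ _ _ [c /(_ (pideal a)) [|l [e [hl _ _]]]]] := hA.
  by apply/parameter_ideal_dim1 => //; exists a.
by exists l.
Qed.

(** The descending ideals aA + m^i become stationary since A / aA has finite length; Nakayama then
    applies to m^i. *)
Lemma max_exp_sub_param a : param a -> exists n, ideal_exp m n `<=` pideal a.
Proof.
move=> pa; have [l hl] := param_length pa.
pose E i := ideal_add (pideal a) (ideal_exp m i).
have hE i : is_ideal (E i).
  by apply: ideal_addP; [exact: ideal_pideal | exact: ideal_expP].
have [||i Ei] := length_descending hl hE _ (fun _ _ _ => I) _.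
- by move=> i; apply: ideal_addl; exact: ideal_expP.
- by move=> i; apply: ideal_add_mono => //; exact: ideal_exp_anti.
exists i; apply: (nakayama hloc hnoeth); [exact: ideal_expP|exact: ideal_pideal|].
rewrite -[ideal_add _ _]/(E i.+1) Ei.
by apply: ideal_addr; exact: ideal_pideal.
Qed.

(** The powers of a and the powers of m are cofinal, so W is also the torsion with respect to powers
    of a. *)
Lemma mem_coh0 a z : param a -> W z <-> exists k, a ^+ k * z = 0.
Proof.
move=> pa; rewrite hW; split=> [[n hn]|[[|k] E]].
- exists n; rewrite mulrC; apply: hn; apply: mem_ideal_exp; exact: param_max.
- by exists 0%N => y _; rewrite -[z]mul1r -(expr0 a) E mul0r.
have [n hn] := max_exp_sub_param (paramX hloc k pa).
by exists n => y /hn [t ->]; rewrite mulrA [z * _]mulrC E mul0r.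
Qed.

Lemma coh0_param_div a z : param a -> W (a * z) -> W z.
Proof.
by move=> pa /(mem_coh0 _ pa) [k E]; apply/(mem_coh0 _ pa);
  exists k.+1; rewrite exprSr -mulrA.
Qed.

(** W is finitely generated, and the exponents of its generators add up to a common one. *)
Lemma coh0_killed a : param a -> exists n, forall z, W z -> a ^+ n * z = 0.
Proof.
move=> pa; have [s Ws] := hnoeth hWI.
have [n hn] : exists n, {in s, forall z, a ^+ n * z = 0}.
  have : {in s, forall z, W z} by move=> z zs; rewrite Ws; exact: sub_ideal_gen.
  elim: s {Ws} => [|x s IH] sW; first by exists 0%N.
  have [|n hn] := IH; first by move=> z zs; apply: sW; rewrite inE zs orbT.
  have [k hk] := (mem_coh0 x pa).1 (sW x (mem_head _ _)).
  exists (n + k)%N => z; rewrite inE exprD => /orP[/eqP ->|/hn zn].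
    by rewrite -mulrA hk mulr0.
  by rewrite mulrAC zn mul0r.
exists n; rewrite Ws; apply: (@ideal_gen_min _ _ [set z | a ^+ n * z = 0]).
  split=> /= [|c x y Ex Ey]; first by rewrite mulr0.
  by rewrite mulrDr mulrCA Ex Ey mulr0 addr0.
by move=> z; exact: hn.
Qed.

(** Multiplication by a power a^(n+1) that kills W maps A onto a^(n+1)A modulo a^(n+2)A with kernel
    aA + W, and for large n the target has length e. *)
Lemma param_multiplicity a e : param a -> multiplicity (pideal a) e ->
  length_quot setT (ideal_add (pideal a) W) e.
Proof.
move=> pa he; have [n0 hn0] := multiplicity_dim1 hdim he.
have [n1 hn1] := coh0_killed pa.
set n := maxn n0 n1; have := hn0 n (leq_maxl _ _).
have hn z : W z -> a ^+ n.+1 * z = 0.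
  move=> /hn1 E; have en : n.+1 = (n.+1 - n1 + n1)%N.
    by rewrite subnK // leqW // leq_maxr.
  by rewrite en exprD -mulrA E mulr0.
rewrite !ideal_exp_pideal => hl.
have [l0 hl0] := param_length pa.
have [|||l [q [hl1 _ _]]] := @length_split _ _ (ideal_add (pideal a) W) _ _ hl0.
- by apply: ideal_addP => //; exact: ideal_pideal.
- exact: ideal_addl.
- by [].

suff h : length_quot (pideal (a ^+ n.+1)) (pideal (a ^+ n.+2)) l.
  by rewrite (length_uniq hl h).
apply/(length_mul (x := a ^+ n.+1) (M := setT) (L := ideal_add (pideal a) W)) => //.
- exact: ideal_pideal.
- apply/seteqP; split=> [_ [_ [t ->] [w Ww <-]]|z [_ [t E]]].
    by split=> //; exists t; rewrite mulrDr (hn w) // !exprS; ring.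
  exists (a * t); first by exists t.
  exists (z - a * t); last by ring.
  apply/(mem_coh0 _ pa); exists n.+1.
  by rewrite mulrBr E !exprS; ring.
apply/seteqP; split=> [_ [t ->]|_ [u [_ [_ [t ->] ->]]]].
  by exists t, 0; split=> //; [exact: (ideal0 (ideal_pideal _))|rewrite addr0].
by exists (u + a * t); rewrite !exprS; ring.
Qed.

(** The difference of l(A/aA) and the multiplicity is the length of (aA + W)/aA, hence of W / (W n
    aA), and the Buchsbaum condition makes it constant. *)
Lemma coh0_param_length : exists c, forall a, param a ->
  length_quot W (W `&` pideal a) c.
Proof.
have [_ _ _ [c hc]] := hA; exists `|c|%N => a pa.
have [|l [e [hl he E]]] := hc (pideal a).
  by apply/parameter_ideal_dim1 => //; exists a.
have hp := ideal_pideal a.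
have [||p [q [h1 h2 El]]] := length_split hl (ideal_addP hp hWI).
- exact: ideal_addl.
- by [].
have E' := length_uniq (param_multiplicity pa he) h1.
have -> : `|c|%N = q by rewrite -E El E' PoszD addrAC subrr add0r.
by apply/length_second_iso => //; rewrite ideal_addC.
Qed.

(** If a^n kills W, then a^(n+1) t in W forces t in W, hence a^(n+1) t = 0. So W n a^(n+1)A = 0, and
    W n aA, which contains it and has the same colength in W, is 0 as well. *)
Lemma coh0_cap_param a : param a -> W `&` pideal a = [set 0].
Proof.
move=> pa; have [c hc] := coh0_param_length; have [n hn] := coh0_killed pa.
have E : W `&` pideal (a ^+ n.+1) = [set 0].
  apply/seteqP; split=> [y [Wy [t Ey]]|_ ->]; last first.
    by split; apply: ideal0 => //; exact: ideal_pideal.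
  rewrite Ey in Wy *; rewrite /= exprSr -mulrA; apply: hn.
  apply: ideal_mull => //; apply: (coh0_param_div (paramX hloc n pa)).
  exact: Wy.
have hI := ideal_setI hWI (ideal_pideal a).
have [||p [q [h1 h2 Ec]]] := length_split (hc _ (paramX hloc n pa)) hI.
- by rewrite E => _ ->; exact: ideal0.
- by move=> z [].
have pq := length_uniq h1 (hc a pa).
apply: length_eq; rewrite -E.
by move: Ec; rewrite pq -[LHS]addn0 => /addnI ->.
Qed.

Lemma param_coh0 a z : param a -> W z -> a * z = 0.
Proof.
move=> pa Wz; have : (W `&` pideal a) (a * z).
  by split; [exact: ideal_mull | exists z].
by rewrite coh0_cap_param.
Qed.

(* If no x + a^k were a parameter, the a-saturations of the ideals generated by
   (x + a) ... (x + a^i) would give arbitrarily long chains modulo a: the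
   factors are pairwise comaximal after inverting a. *)
Lemma exists_param_addX a x : param a -> m x ->
  exists k, param (x + a ^+ k.+1).
Proof.
move=> pa mx; apply: contrapT => no.
have ma := param_max pa.
have mk k : m (x + a ^+ k.+1).
  by apply: idealD => //; rewrite exprS; exact: ideal_mulr.
(* A power of a in (x + a^(k+1))A would make x + a^(k+1) a parameter, since every element of m has a
   power in aA. *)
have npow k n : ~ pideal (x + a ^+ k.+1) (a ^+ n).
  move=> [t Et]; apply: no; exists k; apply: paramP => // y my.
  have [i [s Es]] := param_radical pa my.
  by exists (i * n)%N, (t * s ^+ n); rewrite exprM Es exprMn Et; ring.
pose z i := \prod_(j < i) (x + a ^+ j.+1).
pose E i : set A := [set y | exists n t, a ^+ n * y = z i * t].
have hE i : is_ideal (E i).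
  split; first by exists 0%N, 0; ring.
  move=> c u v [n [t Et]] [n' [t' Et']]; exists (n + n')%N.
  exists (a ^+ n' * c * t + a ^+ n * t'); rewrite exprD.
  by rewrite mulrDr (_ : a ^+ n * a ^+ n' * (c * u) = a ^+ n' * c * (a ^+ n * u));
    [rewrite Et (_ : a ^+ n * a ^+ n' * v = a ^+ n * (a ^+ n' * v));
      [rewrite Et'|]|]; ring.
have dec i : E i.+1 `<=` E i.
  by move=> y [n [t]]; rewrite /z big_ord_recr /= -mulrA => Et; exists n; eexists; exact: Et.
(* For i < k the factors x + a^(i+1) and x + a^(k+1) differ by a^(i+1) times the unit 1 - a^(k-i),
   so they are comaximal up to a power of a. *)
have comax i k : (i <= k)%N -> exists n s t, a ^+ n = z i * s + (x + a ^+ k.+1) * t.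
  elim: i => [|i IH] ik.
    by exists 0%N, 1, 0; rewrite /z big_ord0; ring.
  have [n [s [t En]]] := IH (ltnW ik).
  have [u Eu] : exists u, (1 - a ^+ (k - i)) * u = 1.
    apply: (unit_sub1 hloc); rewrite -(subnSK ik) exprS; exact: ideal_mulr.
  have Ek : a ^+ k.+1 = a ^+ i.+1 * a ^+ (k - i).
    by rewrite -exprD; congr (_ ^+ _); lia.
  exists (n + i.+1)%N, (s * u), (t * a ^+ i.+1 - z i * s * u).
  rewrite /z big_ord_recr /= -/(z i) exprD En Ek.
  transitivity (z i * s * (a ^+ i.+1 * ((1 - a ^+ (k - i)) * u)) +
    (x + a ^+ i.+1 * a ^+ (k - i)) * t * a ^+ i.+1); last by ring.
  by rewrite Eu; ring.
have hp := ideal_pideal a.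
have [l hl] := param_length pa.
have [||i Ei] := length_descending hl (fun i => ideal_addP (hE i) hp) _
  (fun _ _ _ => I) _.
- by move=> i; exact: ideal_addr.
- by move=> i; exact: ideal_add_mono.
(* As [E i] is saturated, stability modulo a gives [E i] inside [E i.+1] + a [E i], and Nakayama
   applies. *)
have sub : E i `<=` E i.+1.
  apply: (nakayama_pideal hloc hnoeth ma) => // y Ey.
  have : ideal_add (E i) (pideal a) y by apply: ideal_addl Ey.
  rewrite -Ei => -[u Eu [_ [v ->] Ey']]; exists u, v; split=> //.
  have [n [t Et]] : E i (a * v).
    by rewrite (_ : a * v = y - u); [apply: idealB => //; exact: dec|rewrite -Ey'; ring].
  by exists n.+1, t; rewrite exprSr -mulrA.
(* Now some a^k [z i] is a multiple of x + a^(i+1); comaximality turns this into a power of a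
   divisible by that factor, against [npow]. *)
have [n [s [t En]]] := comax i i (leqnn i).
have [k [r]] : E i.+1 (z i) by apply: sub; exists 0%N, 1; ring.
rewrite /z big_ord_recr /= -/(z i) => Er.
apply: (npow i (k + n)%N); exists (z i * r * s + a ^+ k * t).
by rewrite exprD En mulrDr mulrA Er; ring.
Qed.

(** x is the difference of the parameters x + a^(k+1) and a^(k+1), both of which annihilate W. *)
Lemma max_coh0 x z : (exists a, param a) -> m x -> W z -> x * z = 0.
Proof.
move=> [a pa] mx Wz; have [k pk] := exists_param_addX pa mx.
rewrite -[x](addrK (a ^+ k.+1)) mulrBl (param_coh0 pk Wz).
by rewrite (param_coh0 (paramX hloc k pa) Wz) subrr.
Qed.

End Buchsbaum.

(** An ideal strictly above m contains 1, so a second strict step is impossible. *)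
Lemma chain_max_le1 (A : comNzRingType) (m : set A) k : is_local m ->
  chain m setT k -> (k <= 1)%N.
Proof.
move=> hloc ch.
suff [[-> _]|[-> _]] : (k = 0%N /\ setT = m) \/ (k = 1%N /\ [set: A] 1) by [].
elim/chain_ind: ch => [_|M1 M2 j _ IH hM1 hM2 [M12 M21]]; first by left.
case: IH => [[-> E]|[_ M11]]; last first.
  by case: M21 => x _; rewrite -[x]mulr1; apply: ideal_mull.
right; split=> //; apply: contrapT => M2n1; apply: M21; rewrite E.
exact: (proper_ideal_sub hloc).
Qed.

(** * Socles modulo parameters *)

Section Socle.
Variables (A : comNzRingType) (m W : set A).
Hypotheses (hA : is_buchsbaum m) (hdim : krull_dim A 1).
Hypotheses (hWI : is_ideal W) (hW : W = local_coh0 m).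
Implicit Types (I J K L M N : set A) (a b x y z : A).

Let hnoeth : noetherian A. Proof. by case: hA. Qed.
Let hloc : is_local m. Proof. by case: hA. Qed.
Let hm : is_ideal m. Proof. exact: maxideal. Qed.

Local Notation param := (param m).

Definition coh0_add a := ideal_add (pideal a) W.
(** The ideal J of the overview: modulo aA + W it is the socle of A/W modulo the image of a. *)
Definition socle a := colon (coh0_add a) m.

Lemma coh0_addP a : is_ideal (coh0_add a).
Proof. by apply: ideal_addP => //; exact: ideal_pideal. Qed.

Lemma mem_coh0_add a z : coh0_add a z <-> exists t w, W w /\ z = a * t + w.
Proof.
split=> [[_ [t ->] [w Ww <-]]|[t [w [Ww ->]]]]; first by exists t, w.
by exists (a * t); [exists t | exists w].
Qed.

Lemma socleP a : is_ideal (socle a).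
Proof. by apply: ideal_colon; exact: coh0_addP. Qed.

Lemma coh0_add_sub_socle a : coh0_add a `<=` socle a.
Proof. by move=> z hz y _; apply: ideal_mulr => //; exact: coh0_addP. Qed.

Lemma colon_sub_socle a : colon (pideal a) m `<=` socle a.
Proof. by move=> z hz y my; apply: ideal_addl => //; exact: hz. Qed.

Lemma coh0_add_sub_colon a : param a -> coh0_add a `<=` colon (pideal a) m.
Proof.
move=> pa z /mem_coh0_add [t [w [Ww ->]]] y my.
have y0 := max_coh0 hA hdim hWI hW (ex_intro _ a pa) my Ww.
by exists (t * y); rewrite mulrDl [w * y]mulrC y0; ring.
Qed.

(** Since a lies in m and is regular modulo W, a z in abA + W forces z in bA + W; cancelling b then
    puts the cofactor in [socle a]. Conversely mW = 0 absorbs the summand v. *)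
Lemma socle_mulP a b z : param a -> param b ->
  socle (a * b) z <-> exists u v, [/\ socle a u, W v & z = b * u + v].
Proof.
move=> pa pb; have mW := max_coh0 hA hdim hWI hW (ex_intro _ a pa).
split=> [hz|[u [v [hu Wv ->]]] y my]; last first.
  have /mem_coh0_add [t [w [Ww E]]] := hu y my; apply/mem_coh0_add.
  exists t, (b * w); split; first exact: ideal_mull.
  by rewrite mulrDl [v * y]mulrC (mW y v) // -mulrA E; ring.
have /mem_coh0_add [t [w [Ww E]]] := hz a (param_max pa).
have Wv : W (z - b * t).
  apply: (coh0_param_div hA hdim hW pa); rewrite (_ : _ * _ = w) //.
  by rewrite mulrBr [a * z]mulrC E; ring.
exists t, (z - b * t); split=> //; last by ring.
move=> y my; have /mem_coh0_add [s [w' [Ww' E']]] := hz y my.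
apply/mem_coh0_add; exists s, (t * y - a * s); split; last by ring.
apply: (coh0_param_div hA hdim hW pb).
rewrite (_ : _ * _ = w' - (z - b * t) * y).
  by apply: idealB => //; exact: ideal_mulr.
by rewrite mulrBl E'; ring.
Qed.

Lemma length_socle_mul a b l : param a -> param b ->
  length_quot (socle a) (coh0_add a) l <->
  length_quot (socle (a * b)) (coh0_add (a * b)) l.
Proof.
move=> pa pb; apply: (length_mul (x := b)).
- exact: socleP.
- exact: coh0_addP.
- apply/seteqP; split=> [z hz|z [_ /mem_coh0_add [t [w [Ww E]]]]].
    split; first exact: coh0_add_sub_socle.
    have /mem_coh0_add [t [w [Ww ->]]] := hz; apply/mem_coh0_add.
    by exists t, (b * w); split; [exact: ideal_mull | ring].
  apply/mem_coh0_add; exists t, (z - a * t); split; last by ring.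
  by apply: (coh0_param_div hA hdim hW pb); rewrite mulrBr E (_ : _ - _ = w) //; ring.
- apply/seteqP; split=> [z /(socle_mulP _ pa pb) [u [v [hu Wv ->]]]|z].
    by exists u, v; split=> //; apply/mem_coh0_add; exists 0, v; split=> //; ring.
  move=> [u [v [hu /mem_coh0_add [t [w [Ww ->]]] ->]]].
  apply/(socle_mulP _ pa pb); exists (u + a * t), w; split=> //; last by ring.
  apply: idealD (socleP a) hu _.
  by apply: coh0_add_sub_socle; apply/mem_coh0_add; exists t, 0; split;
    [exact: ideal0 | ring].
Qed.

(** Both sides are compared with the product ab. The common value will be r(A/W). *)
Lemma length_socle_indep a b l : param a -> param b ->
  length_quot (socle a) (coh0_add a) l -> length_quot (socle b) (coh0_add b) l.
Proof.
move=> pa pb /(length_socle_mul _ pa pb); rewrite mulrC.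
by move/(length_socle_mul _ pb pa).
Qed.

(** An element of the left side is a u + v with u in [socle a] and v in W. Multiplied by y in m it
    becomes a (u y), where the factor a kills the W-part of u y. *)
Lemma socle_sqr a : param a -> socle (a * a) = colon (pideal (a * a)) m.
Proof.
move=> pa; apply/seteqP; split; last exact: colon_sub_socle.
move=> z /(socle_mulP _ pa pa) [u [v [hu Wv ->]]] y my.
have mW := max_coh0 hA hdim hWI hW (ex_intro _ a pa).
have /mem_coh0_add [s [w [Ww E]]] := hu y my; exists s.
rewrite mulrDl [v * y]mulrC (mW y v) // -mulrA E mulrDr (mW a w) //; first ring.
exact: param_max.
Qed.

(** The number w is what W contributes to the colength of aA, the same for every parameter. *)
Lemma length_coh0 :
  exists w, forall a, param a -> length_quot (coh0_add a) (pideal a) w.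
Proof.
have [w hw] := coh0_param_length hA hdim hWI hW.
exists w => a pa; rewrite /coh0_add ideal_addC; apply/length_second_iso => //.
  exact: ideal_pideal.
exact: hw.
Qed.

(** The interval is split along aA + W <= aA : m <= [socle a]; the upper part d is what bounds the
    reduction number. *)
Lemma param_lengths a : param a -> exists lW rW d,
  [/\ length_quot (colon (pideal a) m) (coh0_add a) lW,
      length_quot (socle a) (coh0_add a) rW,
      length_quot (socle a) (colon (pideal a) m) d
    & rW = (d + lW)%N].
Proof.
move=> pa; have [l hl] := param_length hA hdim pa.
have ha := ideal_pideal a; have hI := ideal_colon m ha.
have [||p [q [_ h1 _]]] := length_split hl (socleP a).
- by move=> z hz; apply: coh0_add_sub_socle; exact: ideal_addl.
- by [].
have [||p1 [q1 [h2 _ _]]] := length_split h1 (coh0_addP a).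
- exact: ideal_addl.
- exact: coh0_add_sub_socle.
have [||d [lW [h3 h4 E]]] := length_split h2 hI.
- exact: coh0_add_sub_colon.
- exact: colon_sub_socle.
by exists lW, p1, d.
Qed.

(** * Multiplicity greater than one and the reduction bound *)

Section MultiplicityGt1.
Variable e : nat.
Hypotheses (he : multiplicity m e) (e_gt1 : (1 < e)%N).

(** If m lay in yA + W, then m^n would be generated by y^n for n >= 2, and m^n / m^(n+1), being
    cyclic and killed by m, would have length at most 1, whereas it is e for large n. *)
Lemma max_not_principal y : (exists a, param a) -> m y -> ~ (m `<=` coh0_add y).
Proof.
move=> hp my hy; have mW x w := @max_coh0 _ _ _ hA hdim hWI hW x w hp.
have step x z k : m x -> coh0_add (y ^+ k.+1) z -> pideal (y ^+ k.+2) (x * z).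
  move=> mx /mem_coh0_add [s [w [Ww ->]]]; rewrite mulrDr (mW x w) // addr0.
  have /mem_coh0_add [t [v [Wv ->]]] := hy x mx.
  have v0 : v * (y ^+ k.+1 * s) = 0.
    transitivity (y * (v * (y ^+ k * s))); first by rewrite exprS; ring.
    by rewrite mW //; exact: ideal_mulr.
  by exists (t * s); rewrite mulrDl v0 !exprS; ring.
(* The exponent starts at 2: m itself is only inside yA + W, and one more factor from m removes the
   W-part. *)
have expm k : ideal_exp m k.+2 `<=` pideal (y ^+ k.+2).
  elim: k => [|k IH].
    apply: ideal_mul_sub => [|x z mx hz]; first exact: ideal_pideal.
    by apply: step => //; rewrite expr1; apply: hy; rewrite -(ideal_exp1 hm).
  apply: ideal_mul_sub => [|x z mx hz]; first exact: ideal_pideal.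
  by apply: step => //; apply: ideal_addl => //; exact: IH.
have [n0 /(_ n0.+1 (leqnSn _))] := multiplicity_dim1 hdim he.
set n := n0.+2 => hl.
(* L is the annihilator of the class of y^n in m^n / m^(n+1), so A / L has length e, while m lies in
   L. *)
pose L := [set z | [set: A] z /\ ideal_exp m n.+1 (y ^+ n * z)].
have hLl : length_quot setT L e.
  apply/(length_mul (x := y ^+ n)) => //; first exact: ideal_expP.
  suff <- : ideal_exp m n = [set z | exists u v,
      [/\ [set: A] u, ideal_exp m n.+1 v & z = y ^+ n * u + v]] by [].
  apply/seteqP; split=> [z /expm [t ->]|_ [u [v [_ hv ->]]]].
    by exists t, 0; split=> //; [exact: (ideal0 (ideal_expP _ _))|ring].
  have hn := ideal_expP m n.
  apply: (idealD hn); last exact: ideal_exp_anti.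
  by apply: (ideal_mulr _ hn); exact: mem_ideal_exp.
have [_ hL _] := length_sub hLl.
suff : (e <= 1)%N by rewrite leqNgt e_gt1.
have [L1|L1] := pselect (L 1).
  have E : L = setT by apply/seteqP; split=> // x _; rewrite -[x]mulr1; exact: ideal_mull.
  by rewrite (length_uniq hLl (l := 0%N)) // E; apply: length_self; exact: ideal_setT.
apply: (chain_max_le1 hloc); suff <- : L = m by exact: hLl.1.
apply/seteqP; split; first exact: (proper_ideal_sub hloc).
move=> x mx; split=> //; rewrite mulrC.
by apply: (@mem_ideal_mul _ m (ideal_exp m n)) => //; exact: mem_ideal_exp.
Qed.

(* Otherwise x generates the maximal ideal modulo W. *)
Lemma socle_mul_max a x j : param a -> m x -> socle a j ->
  exists s w, [/\ m s, W w & x * j = a * s + w].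
Proof.
move=> pa mx hj; have hp := ex_intro (fun a => param a) a pa.
have mW x' w' := @max_coh0 _ _ _ hA hdim hWI hW x' w' hp.
have /mem_coh0_add [s [w [Ww E]]] := hj x mx.
exists s, w; split=> //; last by rewrite mulrC.
apply: contrapT => /(unit_of_notin_max hloc) [r Er].
apply: (max_not_principal hp mx) => u mu.
have /mem_coh0_add [t [v [Wv E']]] := hj u mu.
(* Modulo W, j x = a s and j u = a t; eliminating j gives a s u = a t x, and r is the inverse of s,
   so u is x t r modulo W. *)
apply/mem_coh0_add; exists (t * r), (u - x * (t * r)); split; last by ring.
apply: (coh0_param_div hA hdim hW pa).
rewrite (_ : _ * _ = 0); first exact: ideal0.
have h1 : u * (a * s + w) = x * (a * t + v) by rewrite -E -E'; ring.
have h2 : a * s * u = a * t * x.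
  by move: h1; rewrite !mulrDr (mW u w) // (mW x v) // !addr0 => h1; rewrite mulrC h1; ring.
have -> : a * (u - x * (t * r)) = a * (s * r) * u - a * t * x * r by rewrite Er; ring.
by rewrite -h2; ring.
Qed.

(** If the colon ideal contained 1, then m would lie in aA. *)
Lemma colon_sub_max a : param a -> colon (pideal a) m `<=` m.
Proof.
move=> pa; apply: (proper_ideal_sub hloc) => [|h].
  by apply: ideal_colon; exact: ideal_pideal.
apply: (max_not_principal (ex_intro _ a pa) (param_max pa)) => y my.
by apply: ideal_addl => //; rewrite -[y]mul1r; exact: h.
Qed.

(** For x in m, x j = a s + v with s again in m, so i s = a r for some r. Then a x t = a i s = a a
    r, and cancelling a gives x t in aA + W. *)
Lemma colon_mul_socle a i j : param a -> colon (pideal a) m i -> socle a j ->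
  exists t w, [/\ socle a t, W w & i * j = a * t + w].
Proof.
move=> pa hi hj; have hp := ex_intro (fun a => param a) a pa.
have mW x' w' := @max_coh0 _ _ _ hA hdim hWI hW x' w' hp.
have mi := colon_sub_max pa hi.
have /mem_coh0_add [t [w [Ww E]]] := hj i mi.
exists t, w; split=> //; last by rewrite mulrC.
move=> x mx; have [s [v [ms Wv E']]] := socle_mul_max pa mx hj.
have [r Er] := hi s ms.
apply/mem_coh0_add; exists r, (t * x - a * r); split; last by ring.
apply: (coh0_param_div hA hdim hW pa).
rewrite (_ : _ * _ = 0); first exact: ideal0.
have h1 : x * (a * t + w) = i * (a * s + v) by rewrite -E -E'; ring.
rewrite !mulrDr (mW x w) // (mW i v) // !addr0 in h1.
have -> : a * (t * x - a * r) = x * (a * t) - a * (a * r) by ring.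
by rewrite h1 -Er; ring.
Qed.

(* Modulo W, the ideal E k below is a (I / a)^(k + 1), and the fractional ideal I / a
   contains 1 and lies in the ring m : m. *)
Lemma reduction_bound a d : param a ->
  length_quot (socle a) (colon (pideal a) m) d ->
  exists2 k, (k <= d)%N & ideal_exp (colon (pideal a) m) k.+2 =
    ideal_mul (pideal a) (ideal_exp (colon (pideal a) m) k.+1).
Proof.
set I := colon _ _ => pa hd.
have hp := ex_intro (fun a => param a) a pa.
have mW x' w' := @max_coh0 _ _ _ hA hdim hWI hW x' w' hp.
have hI : is_ideal I by apply: ideal_colon; exact: ideal_pideal.
have Im : I `<=` m by exact: colon_sub_max.
have Ia : I a by move=> y _; exists y.
have WI : W `<=` I.
  move=> w Ww; apply: coh0_add_sub_colon => //.
  by apply: ideal_addr => //; exact: ideal_pideal.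
have aW w : W w -> a * w = 0 by apply: mW; exact: param_max.
pose E k : set A := [set z | exists2 w, W w & ideal_exp I k.+1 (a ^+ k * z - w)].
have EI k : is_ideal (E k).
  have hk := ideal_expP I k.+1.
  split; first by exists 0; [exact: ideal0|rewrite mulr0 subr0; exact: ideal0].
  move=> c x y [w Ww hx] [v Wv hy]; exists (c * w + v); first exact: hWI.2.
  rewrite (_ : _ - _ = c * (a ^+ k * x - w) + (a ^+ k * y - v)); last by ring.
  exact: hk.2.
(* Iterating IJ <= aJ + W gives I^(k+1) <= a^k J + W. *)
have expI k z : ideal_exp I k.+1 z -> exists2 j, socle a j & W (z - a ^+ k * j).
  elim: k z => [|k IH] z.
    rewrite ideal_exp1 // => Iz; exists z; first exact: colon_sub_socle.
    by rewrite mul1r subrr; exact: ideal0.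
  move: z; apply: (@ideal_mul_sub _ _ _
      [set z | exists2 j, socle a j & W (z - a ^+ k.+1 * j)]).
    split; first by exists 0; [exact: ideal0 (socleP _)|rewrite mulr0 subr0; exact: ideal0].
    move=> c x y [j hj Wx] [j' hj' Wy]; exists (c * j + j').
      exact: (socleP a).2.
    rewrite (_ : _ - _ = c * (x - a ^+ k.+1 * j) + (y - a ^+ k.+1 * j')); last by ring.
    exact: hWI.2.
  move=> i y Ii /IH [j hj Wy].
  have [t [w [ht Ww Et]]] := colon_mul_socle pa Ii hj; exists t => //.
  rewrite (_ : _ - _ = i * (y - a ^+ k * j) + a ^+ k * w).
    by apply: idealD => //; exact: ideal_mull.
  by rewrite exprS (_ : w = i * j - a * t); [ring|rewrite Et; ring].
have IE k : I `<=` E k.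
  move=> i Ii; exists 0; first exact: ideal0.
  rewrite subr0 mulrC; apply: (@mem_ideal_mul _ I (ideal_exp I k)) => //.
  exact: mem_ideal_exp.
have Einc k : E k `<=` E k.+1.
  move=> z [w Ww hz]; exists 0; first exact: ideal0.
  have := @mem_ideal_mul _ I _ _ _ Ia hz.
  by rewrite mulrBr (aW w) // !subr0 mulrA -exprS.
have Esoc k : E k `<=` socle a.
  move=> z [w Ww /expI [j hj Wj]].
  rewrite -[z](subrK j); apply: (idealD (socleP a)) => //.
  (* The exponent [k.+1] in place of [k] makes the cancelled power a parameter also for k = 0. *)
  apply: colon_sub_socle; apply: WI; apply: (coh0_param_div hA hdim hW (paramX hloc k pa)).
  have -> : a ^+ k.+1 * (z - j) = a * (a ^+ k * z - w - a ^+ k * j) + a * w.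
    by rewrite exprS; ring.
  by apply: idealD => //; exact: ideal_mull.
have [k kd Ek] := length_ascending hd EI IE Esoc Einc.
exists k => //; apply/seteqP; split; last first.
  apply: ideal_mul_sub; first exact: ideal_mulP.
  move=> _ y [t ->] hy.
  exact: (@mem_ideal_mul _ I (ideal_exp I k.+1) _ _ (ideal_mulr _ hI Ia) hy).
(* I lies in m, so I I already lies in aA. *)
have sub2 j : ideal_exp I j.+2 `<=` pideal a.
  elim: j => [|j IH]; last by apply: subset_trans IH; exact: ideal_exp_anti.
  apply: ideal_mul_sub => [|x y Ix hy]; first exact: ideal_pideal.
  by apply: Ix; apply: Im; rewrite -(ideal_exp1 hI).
(* Up to W, z is a^(k+1) j, so j is in [E k.+1], which equals [E k]; hence a^k j is in I^(k+1) up to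
   some w in W. With u = a^k j - w, the difference z - a u lies in W n aA = 0. *)
move=> z hz; have [j hj Wz] := expI _ _ hz.
have [w Ww hw] : E k j.
  rewrite -Ek; exists (a ^+ k.+1 * j - z); first by rewrite -opprB; exact: idealN.
  by rewrite opprB addrC subrK.
set u := a ^+ k * j - w in hw.
have Ezu : z - a * u = z - a ^+ k.+1 * j by rewrite /u mulrBr (aW w) // exprS; ring.
have : (W `&` pideal a) (z - a * u).
  split; first by rewrite Ezu.
  by apply: (idealB (ideal_pideal a)); [exact: sub2 hz | exists u].
rewrite (coh0_cap_param hA hdim hWI hW pa) => /subr0_eq ->.
by apply: mem_ideal_mul => //; exact: mem_pideal.
Qed.

End MultiplicityGt1.

End Socle.

(** * Passage to a quotient ring *)

Section SurjectiveMorphism.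
Variables (A B : comNzRingType) (f : {rmorphism A -> B}).
Hypothesis f_surj : forall y, exists x, f x = y.
Implicit Types (I M N P : set A) (J : set B).

Definition rker := [set x | f x = 0].

Lemma ideal_image I : is_ideal I -> is_ideal (f @` I).
Proof.
move=> hI; split; first by exists 0; [exact: ideal0|exact: rmorph0].
move=> b _ _ [x Ix <-] [y Iy <-]; have [a <-] := f_surj b.
by exists (a * x + y); [exact: hI.2|rewrite rmorphD rmorphM].
Qed.

Lemma ideal_preimage J : is_ideal J -> is_ideal (f @^-1` J).
Proof.
move=> hJ; split=> /= [|a x y Jx Jy]; first by rewrite rmorph0; exact: ideal0.
by rewrite rmorphD rmorphM; exact: hJ.2.
Qed.

Lemma image_preimage_ideal J : f @` (f @^-1` J) = J.
Proof.
apply/seteqP; split=> [_ [x Jx <-] //|y Jy].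
by have [x E] := f_surj y; exists x; rewrite /= E.
Qed.

Lemma mem_image_ideal I x : is_ideal I -> rker `<=` I -> (f @` I) (f x) -> I x.
Proof.
move=> hI kI [y Iy E]; rewrite -[x](subrK y); apply: idealD => //; apply: kI.
by rewrite /rker /= rmorphB E subrr.
Qed.

Lemma preimage_image_ideal I : is_ideal I -> rker `<=` I -> f @^-1` (f @` I) = I.
Proof.
move=> hI kI; apply/seteqP; split=> x; first exact: mem_image_ideal.
by move=> Ix; exists x.
Qed.

Lemma length_image M N l : rker `<=` N ->
  length_quot M N l -> length_quot (f @` M) (f @` N) l.
Proof.
move=> kN hl; have [NM hN hM] := length_sub hl.
apply: (@length_iso _ _ (fun I => f @` I) (fun J => f @^-1` J) _ _ _ _ _ hl) => //.
- move=> K hK NK KM; split; first exact: ideal_image.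
  by apply: preimage_image_ideal => //; exact: subset_trans NK.
- by move=> K hK _ _; split; [exact: ideal_preimage|exact: image_preimage_ideal].
- by move=> K L KL _ [x /KL Lx <-]; exists x.
- by move=> K L KL x /KL.
Qed.

Lemma prime_image P : is_prime P -> rker `<=` P -> is_prime (f @` P).
Proof.
move=> [hP P1 PM] kP; split; first exact: ideal_image.
  by rewrite -(rmorph1 f) => /(mem_image_ideal hP kP).
move=> x y; have [u <-] := f_surj x; have [v <-] := f_surj y.
by rewrite -rmorphM => /(mem_image_ideal hP kP) /PM [Pu|Pv]; [left|right];
  [exists u|exists v].
Qed.

Lemma prime_preimage J : is_prime J -> is_prime (f @^-1` J).
Proof.
move=> [hJ J1 JM]; split; first exact: ideal_preimage.
  by rewrite /= rmorph1.
by move=> x y /=; rewrite rmorphM => /JM.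
Qed.

(** With the kernel inside every prime, image and preimage exchange the prime chains of A and B. *)
Lemma krull_dim_image d : (forall P, is_prime P -> rker `<=` P) ->
  krull_dim A d -> krull_dim B d.
Proof.
move=> kP [[c [cP clt]] hmax]; split.
  exists (fun i => f @` c i); split=> i id.
    by apply: prime_image; [exact: cP|apply: kP; exact: cP].
  have [c1 c2] := clt i id; split; first by move=> _ [x cx <-]; exists x => //; exact: c1.
  have hP := cP i (ltnW id); have [hI _ _] := hP.
  move=> h; apply: c2 => x cx.
  by apply: (mem_image_ideal hI (kP _ hP)); apply: h; exists x.
move=> k [c' [cP' clt']]; apply: hmax; exists (fun i => f @^-1` c' i); split=> i id.
  by apply: prime_preimage; exact: cP'.
have [c1 c2] := clt' i id; split; first by move=> x /c1.
move=> h; apply: c2 => y; have [x <-] := f_surj y; exact: h.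
Qed.

End SurjectiveMorphism.

(** * The quotient by W, presented as a surjection with kernel W *)

Section BuchsbaumQuotient.
Variables (A : comNzRingType) (m W : set A).
Hypotheses (hA : is_buchsbaum m) (hdim : krull_dim A 1).
Hypotheses (hWI : is_ideal W) (W1 : ~ W 1) (hW : W = local_coh0 m).
Variables (B : comNzRingType) (f : {rmorphism A -> B}).
Hypotheses (f_surj : forall y, exists x, f x = y) (f_ker : rker f = W).
Hypothesis ex_param : exists a, param m a.

Let hloc : is_local m. Proof. by case: hA. Qed.
Let hm : is_ideal m. Proof. exact: maxideal. Qed.
Let Wm : W `<=` m. Proof. exact: (proper_ideal_sub hloc). Qed.

Lemma coh0_sqr0 w : W w -> w * w = 0.
Proof. by move=> Ww; apply: (max_coh0 hA hdim hWI hW ex_param) => //; exact: Wm. Qed.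

(** Elements of W have square zero, so W lies in every prime. *)
Lemma krull_dim_coh0_quot : krull_dim B 1.
Proof.
apply: (krull_dim_image f_surj _ hdim) => P [hP _ PM]; rewrite f_ker => w Ww.
by have [] // : P w \/ P w; apply: PM; rewrite coh0_sqr0 //; exact: ideal0.
Qed.

Lemma image_coh0_add a : f @` coh0_add W a = pideal (f a).
Proof.
apply/seteqP; split=> [_ [z /mem_coh0_add [t [w [Ww ->]]] <-]|_ [s ->]].
  have w0 : f w = 0 by move: Ww; rewrite -f_ker.
  by exists (f t); rewrite rmorphD rmorphM w0 addr0.
have [t <-] := f_surj s; exists (a * t); last by rewrite rmorphM.
by apply/mem_coh0_add; exists t, 0; split; [exact: ideal0|rewrite addr0].
Qed.

Lemma mem_pideal_image a x : pideal (f a) (f x) <-> coh0_add W a x.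
Proof.
have kadd : rker f `<=` coh0_add W a.
  by rewrite f_ker; apply: ideal_addr; exact: ideal_pideal.
rewrite -image_coh0_add; split=> [|h]; last by exists x.
by apply: mem_image_ideal kadd; exact: coh0_addP.
Qed.

Lemma image_socle a : f @` socle m W a = colon (pideal (f a)) (f @` m).
Proof.
apply/seteqP; split=> [_ [z hz <-] _ [x mx <-]|y hy].
  by rewrite -rmorphM; apply/mem_pideal_image; exact: hz.
have [z Ez] := f_surj y; exists z => // x mx; apply/mem_pideal_image.
by rewrite rmorphM Ez; apply: hy; exists x.
Qed.

Lemma param_image a : param (f @` m) (f a) <-> param m a.
Proof.
have km : rker f `<=` m by rewrite f_ker.
split=> pa.
  have rad x : (exists n, pideal (f a) (f x ^+ n)) <-> m x.
    rewrite -[exists _, _]/(radical (pideal (f a)) (f x)) pa.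
    by split=> [/(mem_image_ideal hm km) //|mx]; exists x.
  apply: (paramP hloc) => [|x /rad [n]].
    by apply/rad; exists 1%N; rewrite expr1; exact: mem_pideal.
  rewrite -rmorphXn => /mem_pideal_image /mem_coh0_add [t [w [Ww E]]].
  (* Squaring a t + w leaves a multiple of a, because w has square zero. *)
  exists (n + n)%N, (a * t * t + w * t *+ 2); rewrite exprD E.
  have -> : (a * t + w) * (a * t + w) = a * (a * t * t + w * t *+ 2) + w * w by ring.
  by rewrite coh0_sqr0 // addr0.
apply/seteqP; split=> [y [n]|_ [x mx <-]].
  have [x <-] := f_surj y; rewrite -rmorphXn => /mem_pideal_image hx.
  exists x => //; apply: (@max_of_expr _ _ hloc _ n).
  by move: hx; apply: ideal_add_sub => //; apply: pideal_sub => //; exact: param_max.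
have [n [t E]] := param_radical pa mx.
by exists n; rewrite -rmorphXn E rmorphM; exists (f t).
Qed.

(** Every parameter of B lifts to a parameter of A, and all of them give the same socle length, so
    the supremum is this common value. *)
Lemma cm_type_coh0_quot a r : param m a ->
  length_quot (socle m W a) (coh0_add W a) r -> cm_type (f @` m) r.
Proof.
move=> pa hr; have hB := krull_dim_coh0_quot.
have len b : param m b -> length_quot (colon (pideal (f b)) (f @` m)) (pideal (f b)) r.
  move=> pb; rewrite -image_socle -image_coh0_add; apply: length_image => //.
    by rewrite f_ker; apply: ideal_addr; exact: ideal_pideal.
  exact: (length_socle_indep hA hdim hWI hW pa pb).
split=> [|Q /(parameter_ideal_dim1 _ _ hB) [b' ->]].
  exists (pideal (f a)); split; last exact: len.
  by apply/parameter_ideal_dim1 => //; exists (f a) => //; apply/param_image.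
by have [b <-] := f_surj b' => /param_image pb; exists r; split=> //; exact: len.
Qed.

End BuchsbaumQuotient.

(** * The type of A and the final count *)

Lemma cm_type_buchsbaum (A : comNzRingType) (m W : set A) a r w :
  is_buchsbaum m -> krull_dim A 1 -> is_ideal W -> W = local_coh0 m ->
  param m a -> length_quot (socle m W a) (coh0_add W a) r ->
  (forall b, param m b -> length_quot (coh0_add W b) (pideal b) w) ->
  cm_type m (r + w).
Proof.
move=> hA hdim hWI hW pa hr hw; have hloc : is_local m by case: hA.
have paa := paramM hloc pa pa; split.
  (* At the square of a parameter the colon ideal is the whole socle, so r + w is attained. *)
  exists (pideal (a * a)); split; first by apply/parameter_ideal_dim1 => //; exists (a * a).
  rewrite -(socle_sqr hA hdim hWI hW pa); apply: length_add (hw _ paa).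
  exact: (length_socle_indep hA hdim hWI hW pa paa).
(* For any other parameter b the colon ideal lies between bA + W and [socle b], so its length over
   bA is at most r + w. *)
move=> Q /(parameter_ideal_dim1 _ _ hdim) [b -> pb].
have [lW [rW [d [h1 h2 h3 E]]]] := param_lengths hA hdim hWI hW pb.
exists (lW + w)%N; split; first exact: length_add h1 (hw b pb).
have := length_uniq h2 (length_socle_indep hA hdim hWI hW pa pb hr).
by move=> <-; rewrite leq_add2r E leq_addl.
Qed.

Theorem mainTheorem10 (A : comNzRingType) (m : set A)
    (hA : is_buchsbaum m) (hdim : krull_dim A 1)
    (W : idealr A) (hW : [set` W] = local_coh0 m)
    (e : nat) (he : multiplicity m e) (e_gt1 : (1 < e)%N)
    (Q : set A) (hQ : parameter_ideal m Q) :
  let I := colon Q m in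
  exists n r l rW lW : nat,
    [/\ reduction_number Q I n,
        cm_type m r /\ length_quot I Q l,
        cm_type (\pi_{ideal_quot W} @` m) rW /\
          length_quot I (ideal_add Q [set` W]) lW,
        n%:Z <= r%:Z - l%:Z + 1
      & r%:Z - l%:Z + 1 = rW%:Z - lW%:Z + 1].
Proof.
move=> I; have hWI : is_ideal [set` W].
  split=> [|a x y Wx Wy]; first exact: rpred0.
  by apply: rpredD => //; exact: idealMr.
have W1 : ~ [set` W] 1 by rewrite /= idealr1.
have /(parameter_ideal_dim1 _ _ hdim) [a EQ pa] := hQ.
have ex_param := ex_intro (fun a => param m a) a pa.
have [w hw] := length_coh0 hA hdim hWI hW.
have [lW [rW [d [h1 h2 h3 E]]]] := param_lengths hA hdim hWI hW pa.
have [k kd hk] := reduction_bound hA hdim hWI hW he e_gt1 pa h3.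
rewrite /I EQ in hk *; set J := colon _ _ in hk *.
have ex : exists k, (fun k =>
    `[< ideal_exp J k.+1 = ideal_mul (pideal a) (ideal_exp J k) >]) k.
  by exists k.+1; apply/asboolP.
case: (ex_minnP ex) => n /asboolP hn nmin.
have nk : (n <= k.+1)%N by apply: nmin; apply/asboolP.
(* Both r and l exceed their counterparts modulo W by the same w, which gives the equality; the
   bound is n <= k + 1 <= d + 1 with d = rW - lW. *)
exists n, (rW + w)%N, (lW + w)%N, rW, lW; split.
- by split=> // j hj; apply: nmin; apply/asboolP.
- split; last exact: length_add h1 (hw a pa).
  exact: cm_type_buchsbaum hA hdim hWI hW pa h2 hw.
- split; last exact: h1.
  pose f : {rmorphism A -> {ideal_quot W}} := \pi_({ideal_quot W}).
  have f_surj y : exists x, f x = y by exists (repr y); rewrite /f /= reprK.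
  have f_ker : rker f = [set` W].
    apply/seteqP; split=> x; rewrite /rker /= -(rmorph0 f);
      by have := Quotient.idealrBE W x 0; rewrite subr0 => -> /eqP.
  exact: (cm_type_coh0_quot hA hdim hWI W1 hW f_surj f_ker ex_param pa h2).
- lia.
- lia.
Qed.
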